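(* If an algorithm converges linearly in expectation then it converges linearly almost surely. Precisely: let $F$ be a real-valued function on a set $\mathcal{P}$ with minimum value $F^*$, and let $\{\mathbf{x}^{(k)}\}_{k\ge1}$ be a random sequence in $\mathcal{P}$ (with each $F(\mathbf{x}^{(k)})$ a random variable) for which there are deterministic constants $C>0$ and $r\in(0,1)$ with $\mathbb{E}\{F(\mathbf{x}^{(k)})-F^*\}\le C r^{k}$ for every $k\ge1$. Then there exists a deterministic $r'\in(r,1)$ such that $(F(\mathbf{x}^{(k)})-F^* )/(r')^{k}\to0$ almost surely as $k\to\infty$.
   Context: Here ''converges linearly in expectation'' means $\mathbb{E}\{F(\mathbf{x}^{(k)})-F^*\}\le Cr^k$ for all $k$ with deterministic $C>0$, $r\in(0,1)$, and ''converges linearly almost surely'' means that almost surely $F(\mathbf{x}^{(k)})-F^*=o((r')^k)$ for some deterministic $r'\in(0,1)$. *)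

(* Defs.v *)
From HB Require Import structures.
From mathcomp Require Import all_boot all_order all_algebra.
From mathcomp Require Import all_classical all_reals all_analysis.

(* Main.v *)
Require Import Defs.
From HB Require Import structures.
From mathcomp Require Import all_boot all_order all_algebra.
From mathcomp Require Import all_classical all_reals all_analysis.
From mathcomp Require Import measurable_realfun.

Set Implicit Arguments.
Unset Strict Implicit.
Unset Printing Implicit Defensive.

Import Order.TTheory GRing.Theory Num.Theory.
Import numFieldNormedType.Exports.
Local Open Scope classical_set_scope.
Local Open Scope ring_scope.

(** Choose r' strictly between r and 1. By Tonelli, the nonnegative series
    with terms (F(x_k) - Fstar) / r'^k has expectation at most
    C * sum_k (r / r')^k, which is finite; hence it is finite almost surely,
    so its terms tend to 0 almost surely. *)

(** All partial sums are real, so the extended sum is the real limit [C / (1 - q)]. *)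
Lemma geometric_eseries_lty (R : realType) (C q : R) :
  0 <= C -> 0 <= q < 1 -> (\sum_(n <oo) (C * q ^+ n)%:E < +oo)%E.
Proof.
move=> C0 /andP[q0 q1].
have -> : (\sum_(n <oo) (C * q ^+ n)%:E = (C / (1 - q))%:E)%E.
  apply/cvg_lim => //.
  under eq_fun do rewrite sumEFin.
  apply/cvg_EFin; first exact: nearW.
  by apply: cvg_geometric_series; rewrite ger0_norm.
exact: ltry.
Qed.

(** A function analogue of the first Borel-Cantelli lemma, which is the case of indicator
    functions. *)
Lemma summable_integral_ae_cvg0 d (T : measurableType d) (R : realType)
    (mu : {measure set T -> \bar R}) (f : nat -> T -> R) :
  (forall n, measurable_fun [set: T] (f n)) -> (forall n t, 0 <= f n t) ->
  (\sum_(n <oo) \int[mu]_t (f n t)%:E < +oo)%E ->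
  {ae mu, forall t, f n t @[n --> \oo] --> (0 : R)}.
Proof.
move=> mf f0 foo.
have mEf n : measurable_fun [set: T] (EFin \o f n).
  exact/measurable_EFinP.
have Ef0 n t : (0 <= (f n t)%:E)%E by rewrite lee_fin.
have /(integrable_ae measurableT) :
    mu.-integrable [set: T] (fun t => \sum_(n <oo) (f n t)%:E)%E.
  apply/integrableP; split; first by apply: ge0_emeasurable_sum => *; [exact: Ef0|exact: mEf].
  (* The sum is its own absolute value; exchanging sum and integral leaves the series assumed
     finite. *)
  under eq_integral do (rewrite gee0_abs; last exact: nneseries_ge0).
  by rewrite integral_nneseries.
apply: filterS => t /(_ I) sum_fin.
apply: cvg_series_cvg_0; apply: nnseries_is_cvg => //.
by rewrite -ge0_fin_numE//; exact: nneseries_ge0.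
Qed.

Theorem mainTheorem3 (R : realType)
  (d : measure_display) (Omega : measurableType d) (Pr : probability Omega R)
  (V : Type) (P : set V) (F : V -> R) (Fstar : R)
  (Fstar_attained : (F @` P) Fstar)
  (Fstar_lbound : lbound (F @` P) Fstar)
  (x : nat -> Omega -> V)
  (x_in_P : forall k w, (1 <= k)%N -> P (x k w))
  (Fx_measurable : forall k, (1 <= k)%N ->
     measurable_fun [set: Omega] (fun w => F (x k w)))
  (C r : R) (C_gt0 : 0 < C) (r_gt0 : 0 < r) (r_lt1 : r < 1)
  (linear_in_expectation : forall k, (1 <= k)%N ->
     ('E_Pr[(fun w => (F (x k w) - Fstar)%R)] <= (C * r ^+ k)%:E)%E) :
  exists r' : R, [/\ r < r', r' < 1 &
    {ae Pr, forall w,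
      (fun k : nat => (F (x k w) - Fstar) / r' ^+ k) @ \oo --> (0 : R)}].
Proof.
(* The midpoint of [r] and 1 serves as [r'], so that [r / r' < 1]. *)
have [r_lt r'_lt1] := midf_lt r_lt1.
set r' := (r + 1) / 2 in r_lt r'_lt1.
have r'_gt0 : 0 < r' := lt_trans r_gt0 r_lt.
have gap_ge0 k w : 0 <= F (x k.+1 w) - Fstar.
  by rewrite subr_ge0; apply: Fstar_lbound; exists (x k.+1 w) => //; exact: x_in_P.
have mgap k : measurable_fun [set: Omega] (fun w => F (x k.+1 w) - Fstar).
  by apply: measurable_funB => //; exact: Fx_measurable.
(* Shifted by one: the hypotheses say nothing about index 0, where the gap may be negative or
   non-measurable. *)
pose f k w := (r' ^+ k.+1)^-1 * (F (x k.+1 w) - Fstar).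
have f_ge0 k w : 0 <= f k w by rewrite mulr_ge0// invr_ge0 exprn_ge0// ltW.
have mf k : measurable_fun [set: Omega] (f k) by exact: measurable_funM.
exists r'; split => //.
have : {ae Pr, forall w, f k w @[k --> \oo] --> (0 : R)}.
  apply: summable_integral_ae_cvg0 => //.
  have q01 : 0 <= r / r' < 1.
    by rewrite divr_ge0 ?ltW//= ltr_pdivrMr// mul1r.
  apply: le_lt_trans (geometric_eseries_lty (ltW C_gt0) q01).
  apply: lee_nneseries => [k _ _|k _].
    by apply: integral_ge0 => w _; rewrite lee_fin.
  have -> : (\int[Pr]_w (f k w)%:E =
      (r' ^+ k.+1)^-1%:E * \int[Pr]_w (F (x k.+1 w) - Fstar)%:E)%E.
    rewrite -ge0_integralZl_EFin//.
    - by move=> w _; rewrite lee_fin.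
    - exact/measurable_EFinP.
    - by rewrite invr_ge0 exprn_ge0// ltW.
  have := linear_in_expectation k.+1 isT; rewrite unlock => le_exp.
  apply: (@le_trans _ _ ((r' ^+ k.+1)^-1%:E * (C * r ^+ k.+1)%:E)%E).
    by apply: lee_wpmul2l => //; rewrite lee_fin invr_ge0 exprn_ge0// ltW.
  (* The bound is [C * (r / r') ^+ k.+1]; one factor [r / r' <= 1] is dropped to match the geometric
     series starting at exponent 0. *)
  rewrite -EFinM lee_fin mulrC -mulrA -expr_div_n ler_pM2l// exprS.
  case/andP: q01 => q0 q1.
  by rewrite ler_piMl ?exprn_ge0// ltW.
(* Dropping the term of index 0 does not change the limit, so convergence of [f] suffices. *)
apply: filterS => w fw; rewrite -cvg_shiftS/=.
by under eq_fun do rewrite mulrC.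
Qed.
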